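(* For each $\lambda\ge0$, the $\lambda$-slack interleaving distance $d_{\mathrm I,\lambda}^{\mathrm{dynM}}$ is an extended metric between dynamic metric spaces modulo isomorphism. In particular, for $\lambda>0$, $d_{\mathrm I,\lambda}^{\mathrm{dynM}}$ is a (finite) metric between bounded dynamic metric spaces modulo isomorphism.
   Context: A dynamic metric space (DMS) is a pair $\gamma_X=(X,d_X(\cdot))$ where $X$ is a nonempty finite set and $d_X:\mathbb{R}\times X\times X\to\mathbb{R}_+$ satisfies: (i) for each $t\in\mathbb{R}$, $(X,d_X(t))$ is a pseudo-metric space; (ii) for $x\ne x'$ in $X$ the function $t\mapsto d_X(t)(x,x')$ is not identically zero; (iii) for all $x,x'\in X$ the function $t\mapsto d_X(t)(x,x')$ is continuous. DMSs $\gamma_X,\gamma_Y$ are isomorphic if there is a bijection $\varphi:X\to Y$ that is an isometry from $(X,d_X(t))$ to $(Y,d_Y(t))$ for every $t\in\mathbb{R}$. A DMS is bounded if there is $r>0$ with $d_X(t)(x,x')\le r$ for all $t,x,x'$. A tripod $R$ between $X$ and $Y$ is a set $Z$ with surjections $\varphi_X:Z\to X$ and $\varphi_Y:Z\to Y$. For $d_1:X\times X\to\mathbb{R}$ and $d_2:Y\times Y\to\mathbb{R}$, $d_1\le_Rd_2$ means $d_1(\varphi_X(z),\varphi_X(z'))\le d_2(\varphi_Y(z),\varphi_Y(z'))$ for all $z,z'\in Z$ (and symmetrically for $d_2\le_R d_1$). For $t\in\mathbb{R}$, $\varepsilon\ge0$, $[t]^\varepsilon=[t-\varepsilon,t+\varepsilon]$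 and $\big(\bigvee_{[t]^\varepsilon}d_X\big)(x,x')=\min_{s\in[t]^\varepsilon}d_X(s)(x,x')$. $R$ is a $(\lambda,\varepsilon)$-tripod between $\gamma_X$ and $\gamma_Y$ if for all $t\in\mathbb{R}$, $\bigvee_{[t]^\varepsilon}d_X\le_Rd_Y(t)+\lambda\varepsilon$ and $\bigvee_{[t]^\varepsilon}d_Y\le_Rd_X(t)+\lambda\varepsilon$. The $\lambda$-distortion $\mathrm{dis}^{\mathrm{dyn}}_\lambda(R)$ is the infimum of $\varepsilon\ge0$ such that $R$ is a $(\lambda,\varepsilon)$-tripod ($+\infty$ if none), and $d_{\mathrm I,\lambda}^{\mathrm{dynM}}(\gamma_X,\gamma_Y)=\min_R\mathrm{dis}^{\mathrm{dyn}}_\lambda(R)$ over all tripods $R$ between $X$ and $Y$. An extended metric is allowed to take the value $+\infty$. *)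

(* Defs.v *)
From mathcomp Require Import all_boot all_order all_algebra.
From mathcomp Require Import all_classical all_reals all_analysis.

Set Implicit Arguments.
Unset Strict Implicit.
Unset Printing Implicit Defensive.

Import Order.TTheory GRing.Theory Num.Theory.
Import numFieldNormedType.Exports.

Local Open Scope classical_set_scope.
Local Open Scope ring_scope.

Record is_pseudo_metric (R : realType) (X : Type) (d : X -> X -> R) : Prop := {
  pseudo_metric_ge0 : forall x y, 0 <= d x y ;
  pseudo_metric_refl : forall x, d x x = 0 ;
  pseudo_metric_sym : forall x y, d x y = d y x ;
  pseudo_metric_triangle : forall x y z, d x z <= d x y + d y z
}.

Record dms (R : realType) := Dms {
  dms_carrier :> finType ;
  dms_dist : R -> dms_carrier -> dms_carrier -> R ;
  dms_inhabited : inhabited dms_carrier ;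
  dms_pseudo_metric : forall t, is_pseudo_metric (dms_dist t) ;
  dms_not_identically_zero :
    forall x x', x <> x' -> ~ (forall t, dms_dist t x x' = 0) ;
  dms_continuous : forall x x', continuous (fun t => dms_dist t x x')
}.

Definition dms_iso (R : realType) (X Y : dms R) : Prop :=
  exists2 phi : X -> Y, bijective phi &
    forall t x x', dms_dist t (phi x) (phi x') = dms_dist t x x'.

Definition dms_bounded (R : realType) (X : dms R) : Prop :=
  exists2 r : R, 0 < r & forall t (x x' : X), dms_dist t x x' <= r.

Record tripod (X Y : Type) := Tripod {
  tripod_set : Type ;
  tripod_left : tripod_set -> X ;
  tripod_right : tripod_set -> Y ;
  tripod_left_surj : forall x, exists z, tripod_left z = x ;
  tripod_right_surj : forall y, exists z, tripod_right z = y
}.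

(* With (f, g) the two legs of a tripod, in either order, this covers both
   d1 <=_R d2 and d2 <=_R d1. *)
Definition le_along (R : realType) (X Y Z : Type) (f : Z -> X) (g : Z -> Y)
    (d1 : X -> X -> R) (d2 : Y -> Y -> R) : Prop :=
  forall z z', d1 (f z) (f z') <= d2 (g z) (g z').

(* The infimum is a minimum when 0 <= eps: a continuous function on a
   nonempty compact interval attains it. *)
Definition dms_window_min (R : realType) (X : dms R) (eps t : R)
    (x x' : X) : R :=
  inf [set dms_dist s x x' | s in `[t - eps, t + eps]].

Definition is_slack_tripod (R : realType) (lambda eps : R) (X Y : dms R)
    (W : tripod X Y) : Prop :=
  forall t : R,
    le_along (@tripod_left _ _ W) (@tripod_right _ _ W)
      (dms_window_min eps t) (fun y y' => dms_dist t y y' + lambda * eps) /\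
    le_along (@tripod_right _ _ W) (@tripod_left _ _ W)
      (dms_window_min eps t) (fun x x' => dms_dist t x x' + lambda * eps).

Definition distortion (R : realType) (lambda : R) (X Y : dms R)
    (W : tripod X Y) : \bar R :=
  ereal_inf [set eps%:E | eps in
    [set eps : R | 0 <= eps /\ is_slack_tripod lambda eps W]].

(* The infimum is a minimum: the distortion of a tripod depends only on the
   relation it induces between the finite sets X and Y. *)
Definition slack_interleaving_dist (R : realType) (lambda : R)
    (X Y : dms R) : \bar R :=
  ereal_inf [set distortion lambda W | W in [set: tripod X Y]].

(* An extended metric on the quotient T / E, presented on representatives. *)
Record is_extended_metric_modulo (R : realType) (T : Type)
    (E : T -> T -> Prop) (D : T -> T -> \bar R) : Prop := {
  ext_metric_equiv_refl : forall x, E x x ;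
  ext_metric_equiv_sym : forall x y, E x y -> E y x ;
  ext_metric_equiv_trans : forall x y z, E x y -> E y z -> E x z ;
  ext_metric_well_defined :
    forall x x' y y', E x x' -> E y y' -> D x y = D x' y' ;
  ext_metric_ge0 : forall x y, (0 <= D x y)%E ;
  ext_metric_eq0 : forall x y, D x y = 0%E <-> E x y ;
  ext_metric_sym : forall x y, D x y = D y x ;
  ext_metric_triangle : forall x y z, (D x z <= D x y + D y z)%E
}.

Definition is_metric_modulo (R : realType) (T : Type)
    (E : T -> T -> Prop) (D : T -> T -> \bar R) : Prop :=
  is_extended_metric_modulo E D /\ forall x y, D x y \is a fin_num.

Definition bounded_dms (R : realType) := {X : dms R | dms_bounded X}.

(* Main.v *)
(* Since windows are compact and distances continuous, a tripod is a
   (lambda, eps)-tripod iff each distance function of one side lies, up to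
   lambda * eps and a time shift of at most eps, below the corresponding one of
   the other side.  Both errors add up under composition of tripods, which gives
   the triangle inequality.  If the distance of X and Y is 0, then, X * Y having
   finitely many subsets, a single correspondence works for every eps > 0; by
   continuity it preserves distances at every time, and by the non-degeneracy
   of dynamic metric spaces it is the graph of a bijection. *)
Require Import Defs.
From mathcomp Require Import all_boot all_order all_algebra.
From mathcomp Require Import all_classical all_reals all_analysis.
From mathcomp Require Import lra.

Set Implicit Arguments.
Unset Strict Implicit.
Unset Printing Implicit Defensive.

Import Order.TTheory GRing.Theory Num.Theory.
Import numFieldNormedType.Exports.

Local Open Scope classical_set_scope.
Local Open Scope ring_scope.

(** * Domination of functions up to additive slack and time shift *)

Definition shift_le (R : realType) (lambda eps : R) (f g : R -> R) : Prop :=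
  forall t, exists2 s, `|s - t| <= eps & f s <= g t + lambda * eps.

Section ShiftLe.
Variables (R : realType) (lambda : R).
Implicit Types f g h : R -> R.

Lemma shift_leW (e e' : R) f g :
  0 <= lambda -> e <= e' -> shift_le lambda e f g -> shift_le lambda e' f g.
Proof.
move=> l0 ee' fg t; have [s st le_fg] := fg t.
exists s; first exact: le_trans ee'.
by rewrite (le_trans le_fg)// lerD2l ler_wpM2l.
Qed.

Lemma shift_le_trans (e e' : R) f g h :
  shift_le lambda e f g -> shift_le lambda e' g h ->
  shift_le lambda (e + e') f h.
Proof.
move=> fg gh t; have [s st le_gh] := gh t; have [u us le_fg] := fg s.
exists u; last by lra.
by rewrite (le_trans (ler_distD s _ _))// lerD.
Qed.

(** As the allowed shift tends to 0, the witness [s] tends to [t], continuity brings [f s] back to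
    [f t], and the slack vanishes. *)
Lemma shift_le_lim f g t : {for t, continuous f} ->
  (forall e, 0 < e -> shift_le lambda e f g) -> f t <= g t.
Proof.
move=> cf fg; apply/ler_addgt0Pr => e e0.
have e20 : 0 < e / 2 by rewrite divr_gt0.
have [d /= d0 df] := (iffLR (@cvgrPdist_lt _ _ _ _ _ _ _) cf) _ e20.
(* The first bound keeps [s] inside the continuity radius, the second makes [lambda * a] at most
   [e / 2]; the summand 1 covers [lambda = 0]. *)
pose a := Num.min (d / 2) (e / 2 / (`|lambda| + 1)).
have l1 : 0 < `|lambda| + 1 by rewrite ltr_wpDl.
have a0 : 0 < a by rewrite lt_min !divr_gt0.
have [s st le_fg] := fg _ a0 t.
have ad : a < d.
  have : a <= d / 2 by rewrite ge_min lexx.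
  lra.
have lea : lambda * a <= e / 2.
  apply: (@le_trans _ _ ((`|lambda| + 1) * a)).
    by rewrite ler_wpM2r ?(ltW a0)// (le_trans (ler_norm _))// lerDl.
  by rewrite mulrC -ler_pdivlMr// ge_min lexx orbT.
have := df s; rewrite /ball_/= distrC => /(_ (le_lt_trans st ad)).
by rewrite ltr_norml => /andP[_]; lra.
Qed.

End ShiftLe.

(** Forwards, the extreme value theorem provides a time attaining the infimum. Backwards,
    nonnegativity of distances bounds the set below, so its infimum is a genuine lower bound. *)
Lemma dms_window_min_leP (R : realType) (X : dms R) (eps t c : R) (x x' : X) :
  0 <= eps ->
  dms_window_min eps t x x' <= c <->
  exists2 s, `|s - t| <= eps & dms_dist s x x' <= c.
Proof.
move=> e0; rewrite /dms_window_min; split.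
- have ab : t - eps <= t + eps by lra.
  have cd : {within `[t - eps, t + eps], continuous (fun s => dms_dist s x x')}.
    by apply: continuous_subspaceT; exact: dms_continuous.
  have [s sI smin] := EVT_min ab cd => infc.
  exists s; first by move: sI; rewrite in_itv/= ler_distl.
  apply: le_trans infc; apply: lb_le_inf; first by exists (dms_dist s x x'), s.
  by move=> _ [u /= uI <-]; exact: smin.
- move=> [s st]; apply: le_trans; apply: ge_inf.
    by exists 0 => _ [u _ <-]; apply: pseudo_metric_ge0; exact: dms_pseudo_metric.
  by exists s => //=; rewrite in_itv/= -ler_distl.
Qed.

(** * Slack tripods: symmetry, composition and the triangle inequality *)

Section SlackTripod.
Variables (R : realType) (lambda : R).

Lemma is_slack_tripodP (eps : R) (X Y : dms R) (W : tripod X Y) : 0 <= eps ->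
  is_slack_tripod lambda eps W <->
  forall z z' : tripod_set W,
    let dX t := dms_dist t (tripod_left z) (tripod_left z') in
    let dY t := dms_dist t (tripod_right z) (tripod_right z') in
    shift_le lambda eps dX dY /\ shift_le lambda eps dY dX.
Proof.
move=> e0; split=> [slW z z' /=|slW t].
  by split=> t; have [le_lr le_rl] := slW t; exact/dms_window_min_leP.
by split=> z z'; apply/dms_window_min_leP => //;
  [exact: (slW z z').1 | exact: (slW z z').2].
Qed.

Lemma slack_interleaving_dist_le (eps : R) (X Y : dms R) (W : tripod X Y) :
  0 <= eps -> is_slack_tripod lambda eps W ->
  (slack_interleaving_dist lambda X Y <= eps%:E)%E.
Proof.
move=> e0 slW; apply: (@le_trans _ _ (distortion lambda W)).
  by apply: ereal_inf_lbound; exists W.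
by apply: ereal_inf_lbound; exists eps.
Qed.

Lemma slack_interleaving_dist_lt (c : \bar R) (X Y : dms R) :
  (slack_interleaving_dist lambda X Y < c)%E ->
  exists (W : tripod X Y) (eps : R),
    [/\ 0 <= eps, (eps%:E < c)%E & is_slack_tripod lambda eps W].
Proof.
move=> /ereal_inf_lt[_ [W _ <-]] /ereal_inf_lt[_ [eps [e0 slW] <-] ec].
by exists W, eps.
Qed.

Lemma slack_interleaving_dist_ge0 (X Y : dms R) :
  (0 <= slack_interleaving_dist lambda X Y)%E.
Proof.
apply: le_ereal_inf_tmp => _ [W _ <-].
by apply: le_ereal_inf_tmp => _ [eps [e0 _] <-]; rewrite lee_fin.
Qed.

Definition tripod_swap (X Y : Type) (W : tripod X Y) : tripod Y X :=
  Tripod (@tripod_right_surj _ _ W) (@tripod_left_surj _ _ W).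

Lemma slack_interleaving_dist_sym (X Y : dms R) :
  slack_interleaving_dist lambda X Y = slack_interleaving_dist lambda Y X.
Proof.
suff le_sym (U V : dms R) :
    (slack_interleaving_dist lambda U V <= slack_interleaving_dist lambda V U)%E.
  by apply/eqP; rewrite eq_le !le_sym.
apply: le_ereal_inf_tmp => _ [W _ <-].
apply: le_ereal_inf_tmp => _ [eps [e0 slW] <-].
apply: (@slack_interleaving_dist_le _ _ _ (tripod_swap W)) => // t.
by have [? ?] := slW t; split.
Qed.

Section Composition.
Variables (X Y Z : Type) (V : tripod X Y) (W : tripod Y Z).

(** Tripods compose by the fibre product over [Y]: a point of either factor extends to a compatible
    pair because the middle leg of the other is surjective. *)
Let pullback :=
  {p : tripod_set V * tripod_set W | tripod_right p.1 = tripod_left p.2}.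

Let pullback_left_surj x : exists p : pullback, tripod_left (sval p).1 = x.
Proof.
have [v <-] := tripod_left_surj V x.
have [w wv] := tripod_left_surj W (tripod_right v).
by exists (exist _ (v, w) (esym wv)).
Qed.

Let pullback_right_surj z : exists p : pullback, tripod_right (sval p).2 = z.
Proof.
have [w <-] := tripod_right_surj W z.
have [v vw] := tripod_right_surj V (tripod_left w).
by exists (exist _ (v, w) vw).
Qed.

Definition tripod_comp : tripod X Z :=
  Tripod pullback_left_surj pullback_right_surj.

End Composition.

Lemma is_slack_tripod_comp (e e' : R) (X Y Z : dms R)
    (V : tripod X Y) (W : tripod Y Z) : 0 <= e -> 0 <= e' ->
  is_slack_tripod lambda e V -> is_slack_tripod lambda e' W ->
  is_slack_tripod lambda (e + e') (tripod_comp V W).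
Proof.
move=> e0 e'0 /(is_slack_tripodP _ e0) slV /(is_slack_tripodP _ e'0) slW.
apply/is_slack_tripodP => [|/= [[v w] /= vw] [[v' w'] /= vw']].
  exact: addr_ge0.
(* [vw] and [vw'] identify the distance functions on [Y] seen from [V] and from [W], so the two
   dominations chain. *)
have [] := slV v v'; have [] := slW w w'; rewrite /= vw vw' => YZ ZY XY YX.
split; first exact: shift_le_trans XY YZ.
by rewrite addrC; exact: shift_le_trans ZY YX.
Qed.

Lemma slack_interleaving_dist_triangle (X Y Z : dms R) :
  (slack_interleaving_dist lambda X Z <=
   slack_interleaving_dist lambda X Y + slack_interleaving_dist lambda Y Z)%E.
Proof.
(* Near-optimal tripods are generalized together with the distances, so that they survive the case
   split; nonnegativity excludes the value [-oo]. *)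
move: (fun c => @slack_interleaving_dist_lt c X Y).
move: (fun c => @slack_interleaving_dist_lt c Y Z).
move: (slack_interleaving_dist_ge0 X Y) (slack_interleaving_dist_ge0 Y Z).
case: (slack_interleaving_dist lambda X Y) => [a| |] //;
  case: (slack_interleaving_dist lambda Y Z) => [b| |] //;
  rewrite ?addeyy ?leey// => _ _ ltYZ ltXY.
apply/lee_addgt0Pr => e e0.
have e20 : 0 < e / 2 by rewrite divr_gt0.
have [|V [u [u0 ua slV]]] := ltXY (a + e / 2)%:E; first by rewrite lte_fin; lra.
have [|W [v [v0 vb slW]]] := ltYZ (b + e / 2)%:E; first by rewrite lte_fin; lra.
apply: le_trans (slack_interleaving_dist_le (addr_ge0 u0 v0)
  (is_slack_tripod_comp u0 v0 slV slW)) _.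
by move: ua vb; rewrite -!EFinD lee_fin !lte_fin; lra.
Qed.

Section FiniteTripod.
Variables (X Y : dms R) (Z : finType) (f : Z -> X) (g : Z -> Y).
Hypothesis f_surj : forall x, exists z, f z = x.
Hypothesis g_surj : forall y, exists z, g z = y.

(* Universe constraints put [tripod_set] strictly below the sort of finite types
   (and of 'I_n), so Z itself cannot be the set of a tripod; nat, which
   surjects onto Z, can. *)
Lemma slack_interleaving_dist_le_fin (eps : R) : 0 <= eps ->
  (forall z z',
    let dX t := dms_dist t (f z) (f z') in
    let dY t := dms_dist t (g z) (g z') in
    shift_le lambda eps dX dY /\ shift_le lambda eps dY dX) ->
  (slack_interleaving_dist lambda X Y <= eps%:E)%E.
Proof.
move=> e0 slZ.
have [x0] := dms_inhabited X; have [z0 _] := f_surj x0.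
(* Indices past the end of the enumeration fall back on [z0], which exists since [X] is
   inhabited. *)
pose zn := nth z0 (enum Z).
have znK z : zn (index z (enum Z)) = z by rewrite /zn nth_index ?mem_enum.
have fS x : exists n, f (zn n) = x.
  by have [z <-] := f_surj x; exists (index z (enum Z)); rewrite znK.
have gS y : exists n, g (zn n) = y.
  by have [z <-] := g_surj y; exists (index z (enum Z)); rewrite znK.
apply: (@slack_interleaving_dist_le _ X Y (@Tripod X Y nat _ _ fS gS)) => //.
by apply/is_slack_tripodP => // m n; exact: slZ.
Qed.

End FiniteTripod.

(** The graph of the isometry, parametrized by [X], is a tripod of slack 0. *)
Lemma dms_iso_slack_interleaving_dist (X Y : dms R) :
  dms_iso X Y -> slack_interleaving_dist lambda X Y = 0%E.
Proof.
move=> [phi [psi phiK psiK] iso].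
have idS (x : X) : exists z, id z = x by exists x.
have phiS (y : Y) : exists z, phi z = y by exists (psi y).
apply/eqP; rewrite eq_le slack_interleaving_dist_ge0 andbT.
apply: (@slack_interleaving_dist_le_fin _ _ _ id phi idS phiS 0) => // x x'.
by split=> t; exists t; rewrite ?subrr ?normr0// iso mulr0 addr0.
Qed.

End SlackTripod.

(** If each [i] failed at some [f i > 0], an index valid at the minimum of [f] would be valid at its
    own [f i] by monotonicity. *)
Lemma finite_uniform_witness (R : realType) (I : finType) (P : I -> R -> Prop) :
  (forall i e e', e <= e' -> P i e -> P i e') ->
  (forall e, 0 < e -> exists i, P i e) -> exists i, forall e, 0 < e -> P i e.
Proof.
move=> Pmono exP; apply: contrapT => /forallNP noP.
have /choice[f fP] : forall i, exists e, 0 < e /\ ~ P i e.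
  by move=> i; have /existsNP[e /not_implyP[]] := noP i; exists e.
(* The default 1 keeps the minimum positive even when [I] is empty. *)
have min_gt0 : 0 < \big[Order.min/1]_i f i.
  by apply: lt_bigmin => // i _; have [] := fP i.
have [i Pi] := exP _ min_gt0; have [_ []] := fP i.
by apply: Pmono Pi; apply: bigmin_le_cond.
Qed.

(** * Distance zero forces isomorphism *)

Section ZeroDistance.
Variables (R : realType) (lambda : R) (X Y : dms R).
Hypothesis lambda_ge0 : 0 <= lambda.

Lemma slack_interleaving_dist_eq0_corr :
  slack_interleaving_dist lambda X Y = 0%E ->
  exists C : {set X * Y},
    [/\ forall x, exists y, (x, y) \in C, forall y, exists x, (x, y) \in C &
     forall x y x' y' t, (x, y) \in C -> (x', y') \in C ->
       dms_dist t x x' = dms_dist t y y'].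
Proof.
move=> D0.
pose good (C : {set X * Y}) e :=
  [/\ forall x, exists y, (x, y) \in C, forall y, exists x, (x, y) \in C &
   forall x y x' y', (x, y) \in C -> (x', y') \in C ->
     shift_le lambda e (fun t => dms_dist t x x') (fun t => dms_dist t y y') /\
     shift_le lambda e (fun t => dms_dist t y y') (fun t => dms_dist t x x')].
have good_mono C e e' : e <= e' -> good C e -> good C e'.
  move=> ee' [CX CY sC]; split=> // x y x' y' xy xy'.
  by have [? ?] := sC _ _ _ _ xy xy'; split; apply: shift_leW ee' _.
have ex_good e : 0 < e -> exists C, good C e.
  move=> e0; have [|W [u [u0 ue slW]]] := @slack_interleaving_dist_lt _ lambda e%:E X Y.
    by rewrite D0 lte_fin.
  (* The image of [W] in [X * Y] replaces [W], whose underlying set may be infinite. *)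
  exists [set p | `[< exists z : tripod_set W,
    (tripod_left z, tripod_right z) = p >]]%SET.
  apply: good_mono (ltW ue) _; split=> [x|y|x y x' y'].
  - have [z <-] := tripod_left_surj W x.
    by exists (tripod_right z); rewrite inE; apply/asboolP; exists z.
  - have [z <-] := tripod_right_surj W y.
    by exists (tripod_left z); rewrite inE; apply/asboolP; exists z.
  - rewrite !inE => -[z [<- <-]] [z' [<- <-]].
    exact: (iffLR (is_slack_tripodP _ _ u0) slW).
have [C goodC] := finite_uniform_witness good_mono ex_good.
(* The value 1 is arbitrary: totality on both sides does not involve [e]. *)
exists C; have [CX CY _] := goodC 1 ltr01; split=> // x y x' y' t xy xy'.
apply/eqP; rewrite eq_le; apply/andP; split.
- apply: (@shift_le_lim _ lambda (fun t => dms_dist t x x') (fun t => dms_dist t y y')).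
    exact: dms_continuous.
  by move=> e /goodC[_ _ /(_ _ _ _ _ xy xy')[]].
- apply: (@shift_le_lim _ lambda (fun t => dms_dist t y y') (fun t => dms_dist t x x')).
    exact: dms_continuous.
  by move=> e /goodC[_ _ /(_ _ _ _ _ xy xy')[]].
Qed.

Lemma slack_interleaving_dist_eq0_iso :
  slack_interleaving_dist lambda X Y = 0%E -> dms_iso X Y.
Proof.
move=> /slack_interleaving_dist_eq0_corr[C [/choice[phi phiC] /choice[psi psiC] isoC]].
have refl0 (Z : dms R) t (z : Z) : dms_dist t z z = 0.
  by apply: pseudo_metric_refl; exact: dms_pseudo_metric.
exists phi; last by move=> t x x'; rewrite -(isoC _ _ _ _ t (phiC x) (phiC x')).
(* Both [psi (phi x)] and [x] correspond to [phi x], so their distance vanishes at every time;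
   likewise in [Y]. *)
exists psi => [x|y]; apply: contrapT => /dms_not_identically_zero; apply => t.
- by rewrite (isoC _ _ _ _ t (psiC (phi x)) (phiC x)).
- by rewrite -(isoC _ _ _ _ t (phiC (psi y)) (psiC y)).
Qed.

End ZeroDistance.

(** * Isomorphism as an equivalence, bounded spaces, and the theorem *)

Section DmsIso.
Variable R : realType.

Lemma dms_iso_refl (X : dms R) : dms_iso X X.
Proof. by exists id => //; exists id. Qed.

Lemma dms_iso_sym (X Y : dms R) : dms_iso X Y -> dms_iso Y X.
Proof.
move=> [phi [psi phiK psiK] iso]; exists psi; first by exists phi.
by move=> t y y'; rewrite -iso !psiK.
Qed.

Lemma dms_iso_trans (X Y Z : dms R) :
  dms_iso X Y -> dms_iso Y Z -> dms_iso X Z.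
Proof.
move=> [phi bphi iso] [psi bpsi iso']; exists (psi \o phi); first exact: bij_comp.
by move=> t x x' /=; rewrite iso' iso.
Qed.

End DmsIso.

(** The full product [X * Y] serves as tripod: with [eps = (r + r') / lambda] the slack is [r + r'],
    above every distance in either space, so no time shift is needed. *)
Lemma slack_interleaving_dist_bounded (R : realType) (lambda : R) (X Y : dms R) :
  0 < lambda -> dms_bounded X -> dms_bounded Y ->
  slack_interleaving_dist lambda X Y \is a fin_num.
Proof.
move=> l0 [r r0 Xr] [r' r'0 Yr].
have [x0] := dms_inhabited X; have [y0] := dms_inhabited Y.
have fstS (x : X) : exists z : X * Y, z.1 = x by exists (x, y0).
have sndS (y : Y) : exists z : X * Y, z.2 = y by exists (x0, y).
have dist_ge0 (Z : dms R) t (z z' : Z) : 0 <= dms_dist t z z'.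
  by apply: pseudo_metric_ge0; exact: dms_pseudo_metric.
have e0 : 0 <= (r + r') / lambda by rewrite divr_ge0// ltW// addr_gt0.
rewrite ge0_fin_numE; last exact: slack_interleaving_dist_ge0.
apply: le_lt_trans (ltry ((r + r') / lambda)).
apply: (slack_interleaving_dist_le_fin fstS sndS) => // z z'.
split=> t; exists t; rewrite ?subrr ?normr0// mulrCA mulfV ?gt_eqF// mulr1.
- by have := Xr t z.1 z'.1; have := dist_ge0 Y t z.2 z'.2; lra.
- by have := Yr t z.2 z'.2; have := dist_ge0 X t z.1 z'.1; lra.
Qed.

Theorem theorem7p12 (R : realType) :
  (forall lambda : R, 0 <= lambda ->
     is_extended_metric_modulo (@dms_iso R) (slack_interleaving_dist lambda)) /\
  (forall lambda : R, 0 < lambda ->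
     is_metric_modulo
       (fun X Y : bounded_dms R => dms_iso (proj1_sig X) (proj1_sig Y))
       (fun X Y : bounded_dms R =>
          slack_interleaving_dist lambda (proj1_sig X) (proj1_sig Y))).
Proof.
have ext (lambda : R) : 0 <= lambda ->
    is_extended_metric_modulo (@dms_iso R) (slack_interleaving_dist lambda).
  move=> l0.
  (* Invariance follows from the triangle inequality through [X'] and [Y'], whose detours cost 0;
     symmetry of isomorphism gives the reverse inequality. *)
  have le_iso (X X' Y Y' : dms R) : dms_iso X X' -> dms_iso Y Y' ->
      (slack_interleaving_dist lambda X Y <=
       slack_interleaving_dist lambda X' Y')%E.
    move=> XX' /dms_iso_sym Y'Y.
    apply: le_trans (slack_interleaving_dist_triangle _ X X' Y) _.
    rewrite (dms_iso_slack_interleaving_dist _ XX') add0e.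
    apply: le_trans (slack_interleaving_dist_triangle _ X' Y' Y) _.
    by rewrite (dms_iso_slack_interleaving_dist _ Y'Y) adde0.
  split.
  - exact: dms_iso_refl.
  - exact: dms_iso_sym.
  - exact: dms_iso_trans.
  - by move=> X X' Y Y' XX' YY'; apply/eqP; rewrite eq_le !le_iso//; exact: dms_iso_sym.
  - exact: slack_interleaving_dist_ge0.
  - move=> X Y; split; first exact: slack_interleaving_dist_eq0_iso.
    exact: dms_iso_slack_interleaving_dist.
  - exact: slack_interleaving_dist_sym.
  - exact: slack_interleaving_dist_triangle.
split=> // lambda l0.
split=> [|[X bX] [Y bY]]; last exact: slack_interleaving_dist_bounded.
have [Erefl Esym Etrans Dwd Dge0 Deq0 Dsym Dtri] := ext lambda (ltW l0).
split; eauto.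
Qed.
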